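(* Let $M\in C^1\left([0,T_{max});\mathbb{R}^{3\times 3}\right)$ with $\operatorname{tr}(M)=0$. Then $M$ is a solution of the matrix Navier--Stokes equation if and only if the associated strain-vorticity pair $(S,\omega)$ is a solution of the strain-vorticity pair equation.
   Context: Matrix Navier--Stokes equation: $\partial_t M+M^2-\frac13\operatorname{tr}(M^2)I_3=0$, with $\operatorname{tr}(M)=0$. Associated strain and vorticity of a trace-free $M\in\mathbb{R}^{3\times3}$: $S=\frac12(M+M^{tr})$, where $M^{tr}$ is the transpose, and $\omega\in\mathbb{R}^3$ is determined by $$\begin{pmatrix}0&\omega_3&-\omega_2\\-\omega_3&0&\omega_1\\ \omega_2&-\omega_1&0\end{pmatrix}=M^{tr}-M.$$ Strain-vorticity pair equation: for $S\in C^1([0,T_{max});\mathcal{S}^{3\times3})$ (symmetric real $3\times 3$ matrices) with $\operatorname{tr}(S)=0$ and $\omega\in C^1([0,T_{max});\mathbb{R}^3)$, $$\partial_t S+S^2-\tfrac13|S|^2I_3+\tfrac14\omega\otimes\omega-\tfrac1{12}|\omega|^2I_3=0,\qquad \partial_t\omega-S\omega=0,$$ where $|S|^2=\sum_{i,j}S_{ij}^2$ and $(\omega\otimes\omega)_{ij}=\omega_i\omega_j$. *)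

(* Defs.v *)
From HB Require Import structures.
From mathcomp Require Import all_boot all_order all_algebra.
From mathcomp Require Import all_classical all_reals all_analysis.
Set Implicit Arguments.
Unset Strict Implicit.
Unset Printing Implicit Defensive.
Import Order.TTheory GRing.Theory Num.Theory.
Import numFieldNormedType.Exports.
Local Open Scope classical_set_scope.
Local Open Scope ring_scope.

(* The upper end point may be infinite. *)
Definition time_interval (R : realType) (Tmax : \bar R) : set R :=
  [set t : R | 0 <= t /\ (t%:E < Tmax)%E].

(* Derivative of a function of a real variable relative to a set D, given by
   the limit of difference quotients over points of D only. It is two-sided at
   interior points of D; at t = 0 in D = [0, Tmax[ it is the right derivative.
   The library's derive1 is always two-sided, hence not usable at t = 0. *)
Definition diff_quot (R : realType) (V : normedModType R) (f : R -> V) (t : R) :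
  R -> V := fun s => (s - t)^-1 *: (f s - f t).

Definition derivable_within (R : realType) (V : normedModType R) (D : set R)
    (f : R -> V) (t : R) : Prop :=
  cvg (diff_quot f t s @[s --> within D t^']).

Definition deriv_within (R : realType) (V : normedModType R) (D : set R)
    (f : R -> V) (t : R) : V :=
  lim (diff_quot f t s @[s --> within D t^']).

Definition C1_on (R : realType) (V : normedModType R) (D : set R)
    (f : R -> V) : Prop :=
  (forall t, D t -> derivable_within D f t) /\
  {within D, continuous (deriv_within D f)}.

Definition sqnorm (R : realType) (m n : nat) (A : 'M[R]_(m, n)) : R :=
  \sum_(i < m) \sum_(j < n) A i j ^+ 2.

Definition strain (R : realType) (M : 'M[R]_3) : 'M[R]_3 :=
  2^-1 *: (M + M^T).

(* The sign convention is vort_mx w *m x = x \times w (cross product). *)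
Definition vort_mx (R : realType) (w : 'cV[R]_3) : 'M[R]_3 :=
  let w1 := w (inord 0) 0 in let w2 := w (inord 1) 0 in
  let w3 := w (inord 2) 0 in
  \matrix_(i < 3, j < 3)
    nth 0 (nth [::] [:: [:: 0; w3; - w2];
                        [:: - w3; 0; w1];
                        [:: w2; - w1; 0] ] i) j.

Definition vorticity (R : realType) (M : 'M[R]_3) : 'cV[R]_3 :=
  let A := M^T - M in
  \col_(i < 3) nth 0 [:: A (inord 1) (inord 2);
                         A (inord 2) (inord 0);
                         A (inord 0) (inord 1)] i.

Lemma vorticityP (R : realType) (M : 'M[R]_3) (w : 'cV[R]_3) :
  vort_mx w = M^T - M <-> w = vorticity M.
Proof.
have e (i : 'I_3) : [\/ i = inord 0, i = inord 1 | i = inord 2].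
  case: i => -[|[|[|//]]] h; [constructor 1|constructor 2|constructor 3];
    by apply/val_inj; rewrite /= inordK.
split=> [h|->].
  apply/colP => i; rewrite /vorticity -h !mxE.
  by case: (e i) => ->; rewrite !inordK.
apply/matrixP => i j; rewrite /vort_mx /vorticity !mxE.
by case: (e i) => ->; case: (e j) => ->; rewrite !inordK //= ?subrr ?opprB.
Qed.

Definition matrix_NS_solution (R : realType) (Tmax : \bar R)
    (M : R -> 'M[R]_3) : Prop :=
  let I := time_interval Tmax in
  [/\ C1_on I M,
      forall t, I t -> \tr (M t) = 0
    & forall t, I t ->
        deriv_within I M t + M t *m M t
          - (3^-1 * \tr (M t *m M t))%:M = 0].

Definition strain_vorticity_solution (R : realType) (Tmax : \bar R)
    (S : R -> 'M[R]_3) (w : R -> 'cV[R]_3) : Prop :=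
  let I := time_interval Tmax in
  [/\ C1_on I S,
      C1_on I w,
      forall t, I t -> (S t)^T = S t,
      forall t, I t -> \tr (S t) = 0
    & forall t, I t ->
        deriv_within I S t + S t *m S t - (3^-1 * sqnorm (S t))%:M
          + 4^-1 *: (w t *m (w t)^T) - (12^-1 * sqnorm (w t))%:M = 0
        /\ deriv_within I w t - S t *m w t = 0].

(* Main.v *)
Require Import Defs.
From HB Require Import structures.
From mathcomp Require Import all_boot all_order all_algebra.
From mathcomp Require Import all_classical all_reals all_analysis.
From mathcomp Require Import ring.
Import Order.TTheory GRing.Theory Num.Theory.
Import numFieldNormedType.Exports.
Local Open Scope classical_set_scope.
Local Open Scope ring_scope.

(** The map [M |-> (strain M, vorticity M)] is linear and injective: it encodes
    the symmetric and the antisymmetric part of [M]. Hence the residual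
    [M' + M^2 - (tr M^2 / 3) I] of the matrix equation vanishes at a time [t]
    iff both its strain and its vorticity do, and it remains to see that these
    are the residuals of the two equations of the pair.

    Derivatives commute with the two linear maps because linear maps out of a
    space of matrices are continuous; this also transfers the C1 regularity
    from [M] to the pair ([C1_on_linear], [deriv_within_linear]). For the
    quadratic term write [M = S + A] with [S] symmetric and [A] antisymmetric,
    so that [A x = (w \times x) / 2]. The symmetric part of [M^2] is
    [S^2 + A^2], where [A^2 = (w w^T - |w|^2 I) / 4], and taking the trace gives
    [tr M^2 = |S|^2 - |w|^2 / 2]; this is [strain_quadratic]. The antisymmetric
    part is [S A + A S], the matrix of the cross product with
    [((tr S) w - S w) / 2], so for trace-free [M] its vorticity is [- S w]; this
    is [vorticity_quadratic]. *)

(** A linear map out of a space of matrices is a finite combination of the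
    coordinate functions, with the images of the elementary matrices as
    coefficients. *)
Lemma mx_linear_continuous (R : realType) (m n : nat) (W : normedModType R)
    (f : {linear 'M[R]_(m, n) -> W}) : continuous f.
Proof.
have fE : (f : _ -> _) =
    (fun X => \sum_(i < m) \sum_(j < n) X i j *: f (delta_mx i j)).
  apply/funext => X; rewrite {1}(matrix_sum_delta X) linear_sum.
  apply: eq_bigr => i _; rewrite linear_sum; apply: eq_bigr => j _.
  exact: linearZ.
rewrite fE; apply: (continuous_big add_continuous) => i _.
apply: (continuous_big add_continuous) => j _.
move=> X; apply: (@cvgZr_tmp _ _ _ (nbhs X) _
  (fun Y : 'M[R]_(m, n) => Y i j)).
exact: coord_continuous.
Qed.

(** Every time before [Tmax] is a limit of later times before [Tmax]. This makes
    the limits that define [deriv_within] unique. *)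
Lemma time_interval_dnbhs_proper (R : realType) (Tmax : \bar R) (t : R) :
  time_interval Tmax t -> ProperFilter (within (time_interval Tmax) t^').
Proof.
move=> [t0 tT]; apply: Build_ProperFilter => D0.
have D_right : \forall s \near t^'+, time_interval Tmax s.
  case: Tmax tT {D0} => [T|_|//].
    rewrite lte_fin => tT; near=> s; split.
      by rewrite (le_trans t0)// ltW.
    by rewrite lte_fin; near: s; exact: nbhs_right_lt.
  by near=> s; split; [rewrite (le_trans t0)// ltW|exact: ltry].
apply: (@filter_not_empty _ t^'+); move: D_right; apply: filter_app.
have {}D0 : \forall s \near t, s != t -> time_interval Tmax s -> False := D0.
by apply: (filterS _ D0) => s D0s ts Ds; apply: D0s => //; rewrite gt_eqF.
Unshelve. all: by end_near.
Qed.

Section LinearImage.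
Variables (R : realType) (V W : normedModType R) (f : {linear V -> W}).
Variables (D : set R) (u : R -> V).
Hypothesis f_cont : continuous f.
Hypothesis D_proper : forall t, D t -> ProperFilter (within D t^').

Lemma diff_quot_linear t :
  diff_quot (fun s => f (u s)) t = f \o diff_quot u t.
Proof. by apply/funext => s; rewrite /diff_quot /= linearZ_LR (linearB f). Qed.

Lemma cvg_diff_quot_linear t : derivable_within D u t ->
  diff_quot (fun s => f (u s)) t s @[s --> within D t^'] -->
    f (deriv_within D u t).
Proof.
move=> du; rewrite diff_quot_linear.
exact: continuous_cvg (f_cont _) du.
Qed.

Lemma derivable_within_linear t : derivable_within D u t ->
  derivable_within D (fun s => f (u s)) t.
Proof. by move=> du; apply/cvg_ex; eexists; exact: cvg_diff_quot_linear. Qed.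

Lemma deriv_within_linear t : D t -> derivable_within D u t ->
  deriv_within D (fun s => f (u s)) t = f (deriv_within D u t).
Proof.
move=> Dt du; have DP := D_proper t Dt.
by apply: cvg_lim; [exact: norm_hausdorff|exact: cvg_diff_quot_linear].
Qed.

Lemma C1_on_linear : C1_on D u -> C1_on D (fun s => f (u s)).
Proof.
move=> [du cdu]; split=> [t Dt|]; first exact/derivable_within_linear/du.
apply: (@subspace_eq_continuous _ _ _ (f \o deriv_within D u)).
  move=> t /set_mem Dt; apply/esym/deriv_within_linear ; [exact: Dt|exact: du].
move=> t.
exact: (@continuous_comp (subspace D) V W _ f t (cdu t) (f_cont _)).
Qed.

End LinearImage.

Lemma ord3P (i : 'I_3) : [\/ i = inord 0, i = inord 1 | i = inord 2].
Proof.
by case: i => -[|[|[|//]]] h; [constructor 1|constructor 2|constructor 3];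
  apply/val_inj; rewrite /= inordK.
Qed.

Lemma inord3_eq (a b : nat) : (a < 3)%N -> (b < 3)%N ->
  (inord a == inord b :> 'I_3) = (a == b).
Proof. by move=> a3 b3; rewrite -val_eqE /= !inordK. Qed.

Lemma sum3E (V : nmodType) (F : 'I_3 -> V) :
  \sum_(i < 3) F i = F (inord 0) + F (inord 1) + F (inord 2).
Proof.
rewrite !big_ord_recl big_ord0 addr0 addrA.
by congr (F _ + F _ + F _); apply/val_inj; rewrite /= inordK.
Qed.

(** Turns an entry of a matrix expression into a polynomial in the entries of
    the variables. All indices are kept in the form [inord k], the one used by
    [vorticity], so that equal entries are syntactically equal for [field]. *)
Local Ltac mx3_entries :=
  rewrite /sqnorm /mxtrace /strain /vorticity ?(mxE, sum3E, big_ord1);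
  rewrite ?inord3_eq ?inordK //=.

Lemma strain_is_linear (R : realType) : linear (@strain R).
Proof.
move=> a X Y; apply/matrixP => i j; rewrite !mxE; ring.
Qed.
HB.instance Definition _ (R : realType) :=
  GRing.isLinear.Build R 'M[R]_3 'M[R]_3 _ (@strain R) (@strain_is_linear R).

Lemma vorticity_is_linear (R : realType) : linear (@vorticity R).
Proof.
move=> a X Y; apply/colP => i; rewrite !mxE.
by case: i => -[|[|[|//]]] h /=; ring.
Qed.
HB.instance Definition _ (R : realType) :=
  GRing.isLinear.Build R 'M[R]_3 'cV[R]_3 _ (@vorticity R)
    (@vorticity_is_linear R).

Lemma trmx_strain (R : realType) (X : 'M[R]_3) : (strain X)^T = strain X.
Proof. by apply/matrixP => i j; rewrite !mxE addrC. Qed.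

Lemma mxtrace_strain (R : realType) (X : 'M[R]_3) : \tr (strain X) = \tr X.
Proof.
by rewrite /strain linearZ linearD /= mxtrace_tr; field.
Qed.

(** Zero vorticity makes [X] symmetric, hence equal to its strain. *)
Lemma strain_vorticity_eq0 (R : realType) (X : 'M[R]_3) :
  strain X = 0 -> vorticity X = 0 -> X = 0.
Proof.
move=> SX /esym/vorticityP wX.
have sym : X^T = X.
  by apply/eqP; rewrite -subr_eq0 -wX; apply/eqP/matrixP => i j;
    rewrite /vort_mx !mxE; case: (ord3P i) => ->; case: (ord3P j) => ->;
    rewrite !inordK //= ?oppr0.
move: SX; rewrite /strain sym -mulr2n -(scaler_nat 2 X) scalerA.
by rewrite mulVf ?scale1r.
Qed.

(** The symmetric part of the quadratic term. The two multiples of the identity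
    come from [A^2] and from the trace of [M^2]:
    [- |w|^2 / 4 + |w|^2 / 6 = - |w|^2 / 12]. *)
Lemma strain_quadratic (R : realType) (X : 'M[R]_3) :
  strain (X *m X - (3^-1 * \tr (X *m X))%:M) =
  strain X *m strain X - (3^-1 * sqnorm (strain X))%:M
    + 4^-1 *: (vorticity X *m (vorticity X)^T)
    - (12^-1 * sqnorm (vorticity X))%:M.
Proof.
apply/matrixP => i j.
by case: (ord3P i) => ->; case: (ord3P j) => ->; mx3_entries; field.
Qed.

(** The antisymmetric part of the quadratic term. The cross product matrices
    satisfy [S A + A S = (tr S) A - B], where [B] is the cross product matrix of
    [S w / 2]; a zero trace leaves only the vortex stretching term [- S w]. The
    multiple of the identity is symmetric and has no vorticity. *)
Lemma vorticity_quadratic (R : realType) (X : 'M[R]_3) : \tr X = 0 ->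
  vorticity (X *m X - (3^-1 * \tr (X *m X))%:M) = - (strain X *m vorticity X).
Proof.
rewrite {1}/mxtrace sum3E => /eqP; rewrite addr_eq0 => /eqP tr0.
have {}tr0 : X (inord 2) (inord 2) =
    - (X (inord 0) (inord 0) + X (inord 1) (inord 1)).
  by rewrite tr0 opprK.
apply/colP => i.
by case: (ord3P i) => ->; mx3_entries; rewrite tr0; field.
Qed.

Theorem proposition1p6 (R : realType) (Tmax : \bar R) (hT : (0 < Tmax)%E)
    (M : R -> 'M[R]_3)
    (hM : C1_on (time_interval Tmax) M)
    (htr : forall t, time_interval Tmax t -> \tr (M t) = 0) :
  matrix_NS_solution Tmax M <->
  strain_vorticity_solution Tmax (fun t => strain (M t))
    (fun t => vorticity (M t)).
Proof.
set I := time_interval Tmax.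
have IP t : I t -> ProperFilter (within I t^').
  exact: time_interval_dnbhs_proper.
have dM t : I t -> derivable_within I M t by case: hM => + _; exact.
have dS t : I t ->
    deriv_within I (fun s => strain (M s)) t = strain (deriv_within I M t).
  by move=> It; apply: deriv_within_linear => //;
    [exact: mx_linear_continuous|exact: dM].
have dw t : I t -> deriv_within I (fun s => vorticity (M s)) t =
    vorticity (deriv_within I M t).
  by move=> It; apply: deriv_within_linear => //;
    [exact: mx_linear_continuous|exact: dM].
(* The residual of the matrix equation, whose strain and vorticity are the
   residuals of the equations of the pair. *)
pose res t := deriv_within I M t + M t *m M t - (3^-1 * \tr (M t *m M t))%:M.
have resS t : I t -> strain (res t) =
    deriv_within I (fun s => strain (M s)) t + strain (M t) *m strain (M t)
      - (3^-1 * sqnorm (strain (M t)))%:M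
      + 4^-1 *: (vorticity (M t) *m (vorticity (M t))^T)
      - (12^-1 * sqnorm (vorticity (M t)))%:M.
  by move=> It; rewrite /res -addrA linearD /= strain_quadratic dS// !addrA.
have resw t : I t -> vorticity (res t) =
    deriv_within I (fun s => vorticity (M s)) t
      - strain (M t) *m vorticity (M t).
  move=> It; rewrite /res -addrA linearD /= vorticity_quadratic ?dw//.
  exact: htr.
split=> [[_ _ res0]|[_ _ _ _ pair0]].
- split.
  + by apply: C1_on_linear => //; exact: mx_linear_continuous.
  + by apply: C1_on_linear => //; exact: mx_linear_continuous.
  + by move=> t _; exact: trmx_strain.
  + by move=> t It; rewrite mxtrace_strain; exact: htr.
  + move=> t It; rewrite -resS// -resw// (res0 t It : res t = 0).
    by rewrite !linear0.
- split=> // t It; have [S0 w0] := pair0 t It.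
  by apply: strain_vorticity_eq0; [rewrite resS|rewrite resw].
Qed.
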